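(* In the common priority model, under the Reveal policy (with students playing the Bayesian Nash equilibrium): (1) From an ex-post view, the outcome of $\mathrm{DA}^\ell$ coincides with the dominant strategy outcome of deferred acceptance with unconstrained rank-order lists (given the same lottery). In particular, no students are unmatched. (2) From an interim view, and also from an ex-ante view, students have equal probabilities of attending each school, which is equivalent to the random assignment $\left(\frac{q_s}{n}\cdot s\right)_{s\in S}$, i.e. every student attends each school $s\in S$ with probability $\frac{q_s}{n}$.
   Context: Common priority model. There are $n$ students $I=\{i_1,\dots,i_n\}$ and $m$ schools $S=\{s_1,\dots,s_m\}$. Each school $s$ has capacity $q_s\in\mathbb N$, and $\sum_{s\in S}q_s=n$. Each student $i$ has a utility vector $\mathbf v^i=(v^i_1,\dots,v^i_m)$, where $v^i_k\in[0,1]$ is his utility of attending $s_k$. Each $\mathbf v^i$ is drawn independently from a finite set $\mathcal V$ of vectors $(v_k)_{k=1}^m\in[0,1]^m$ with $v_1>v_2>\cdots>v_m$, with probability $f(\mathbf v^i)\in(0,1)$; so all students have the ordinal preference $s_1\succ s_2\succ\cdots\succ s_m$. Students know their own utilities but not the others', except for the distribution $f$; the number of students and the capacities are common knowledge. All students are in priority ties for all schools. Ties are broken at all schools by a single lottery, a one-to-one mapping $\pi:I\to\{1,\dots,n\}$ drawn uniformly at random; $\pi(i)<\pi(j)$ means $i$ is ranked above $j$. A matching assigns each student to a school or leaves him unmatched, respecting capacities. Each student submits a rank-order list (ROL) of at most $\ell$ schools, where $\ell<m$. The mechanism is $\mathrm{DA}^\ell$, student-proposing deferred acceptance with these constrained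 lists: in each step every unassigned student applies to the best school on his ROL that has not rejected him, and each school tentatively admits, up to capacity, the highest-ranked applicants among those tentatively admitted in the previous step and the new applicants. Deferred acceptance with unconstrained ROLs is the same procedure when students may rank all $m$ schools; its dominant strategy outcome is the one where students report complete and true preferences. Reveal policy: utilities are realized; the lottery is drawn and each student $i$ is informed of his own lottery number $\pi(i)$ only; students then submit ROLs; the matching is found by $\mathrm{DA}^\ell$. Ex-ante refers to the timing before utilities are realized; interim to the timing after utilities are realized but before the lottery is drawn; ex-post to the timing after the lottery has been drawn and ROLs have been submitted. *)

(* Defs.v *)
From mathcomp Require Import all_boot all_order all_fingroup all_algebra.
From mathcomp Require Import finmap.

Set Implicit Arguments.
Unset Strict Implicit.
Unset Printing Implicit Defensive.

Import Order.TTheory GRing.Theory Num.Theory.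
Local Open Scope ring_scope.

(* Students are 'I_n, schools are 'I_m, and both are numbered from 0: the k-th
   school of the common preference is k : 'I_m.  A lottery is a permutation pi
   of 'I_n; pi i is the lottery number of i, also counted from 0, and
   pi i < pi j means that i is ranked above j at every school. *)

Section DeferredAcceptance.

Variables (n m : nat) (q : 'I_m -> nat).

Implicit Types (P : 'I_n -> seq 'I_m) (pi : {perm 'I_n}).
Implicit Types (rej : {set 'I_n * 'I_m}).

(* (i, s) \in rej means that s has already rejected i.  A tentatively admitted
   student is held by the best school on his list that has not rejected him, so
   this is his current school if he is held and the school to which he applies
   next otherwise; it is None once his list is exhausted. *)
Definition application P rej (i : 'I_n) : option 'I_m :=
  ohead [seq s <- P i | (i, s) \notin rej].

(* Among the students it holds and its new applicants, each school s keeps the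
   q s highest-ranked ones and rejects the others. *)
Definition da_step P pi rej : {set 'I_n * 'I_m} :=
  rej :|: [set x : 'I_n * 'I_m |
    (application P rej x.1 == Some x.2) &&
    (q x.2 <= #|[set j : 'I_n | (application P rej j == Some x.2)
                                && (pi j < pi x.1)%N]|)%N].

(* Every step before termination adds a rejection and there are only n * m
   pairs, so n * m steps always reach the end of the procedure. *)
Definition DA P pi (i : 'I_n) : option 'I_m :=
  application P (iter (n * m) (da_step P pi) set0) i.

End DeferredAcceptance.

(* Submitted lists: at most l distinct schools, possibly none, best first. *)
Definition rol (m l : nat) : Type := {L : l.-bseq 'I_m | uniq L}.

Definition rol_seq m l (L : rol m l) : seq 'I_m := bseqval (val L).
Coercion rol_seq : rol >-> seq.

Section RevealGame.

Variables (R : realFieldType) (n m l : nat) (q : 'I_m -> nat).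
Variables (V : {fset 'rV[R]_m}) (f : V -> R) (u0 : R).

Definition truthful (v : V) : seq 'I_m :=
  sort (fun j k : 'I_m => val v 0 k <= val v 0 j) (enum 'I_m).

(* u0 is the utility of being unmatched; it is left arbitrary here. *)
Definition utility (v : V) (a : option 'I_m) : R :=
  if a is Some k then val v 0 k else u0.

(* A play of the game: utilities, lottery, submitted lists. *)
Definition play : Type :=
  ({ffun 'I_n -> V} * {perm 'I_n} * {ffun 'I_n -> rol m l})%type.

Definition types (w : play) : {ffun 'I_n -> V} := w.1.1.
Definition lottery (w : play) : {perm 'I_n} := w.1.2.
Definition lists (w : play) : {ffun 'I_n -> rol m l} := w.2.

Definition outcome_DAl (w : play) : 'I_n -> option 'I_m :=
  DA q (fun i => lists w i) (lottery w).

Definition outcome_DA (w : play) : 'I_n -> option 'I_m :=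
  DA q (fun i => truthful (types w i)) (lottery w).

(* tau v r L is the probability of submitting L when one's utility vector is v
   and one's lottery number is r. *)
Definition strategy : Type := V -> 'I_n -> rol m l -> R.

Definition is_strategy (tau : strategy) : Prop :=
  forall v r, (forall L, 0 <= tau v r L) /\ \sum_L tau v r L = 1.

Definition mass (sigma : 'I_n -> strategy) (w : play) : R :=
  (\prod_i f (types w i)) * (n`!%:R)^-1
  * \prod_i sigma i (types w i) (lottery w i) (lists w i).

Definition Pr (sigma : 'I_n -> strategy) (E : pred play) : R :=
  \sum_(w | E w) mass sigma w.

Definition condPr (sigma : 'I_n -> strategy) (A E : pred play) : R :=
  Pr sigma (predI A E) / Pr sigma E.

Definition condE (sigma : 'I_n -> strategy) (X : play -> R) (E : pred play) : R :=
  (\sum_(w | E w) mass sigma w * X w) / Pr sigma E.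

(* What student i knows when he submits his list. *)
Definition info (i : 'I_n) (v : V) (r : 'I_n) : pred play :=
  fun w => (types w i == v) && (lottery w i == r).

Definition deviate (sigma : 'I_n -> strategy) (i : 'I_n) (tau : strategy) :
    'I_n -> strategy :=
  fun j => if j == i then tau else sigma j.

Definition payoff (i : 'I_n) (w : play) : R :=
  utility (types w i) (outcome_DAl w i).

(* Interim form: given every utility vector and lottery number of every student,
   no (possibly mixed) deviation raises his conditional expected payoff.  The
   conditioning event has the same positive probability under any strategies. *)
Definition bayes_nash (sigma : 'I_n -> strategy) : Prop :=
  (forall i, is_strategy (sigma i)) /\
  forall (i : 'I_n) (tau : strategy), is_strategy tau ->
  forall (v : V) (r : 'I_n),
    condE (deviate sigma i tau) (payoff i) (info i v r)
    <= condE sigma (payoff i) (info i v r).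

End RevealGame.

(* Main.v *)
(** Under common priorities deferred acceptance is a serial dictatorship, so it
    is determined by what each lottery number finds left over.  Since all
    students rank the schools alike, lottery number [r] is due the school whose
    block of seats contains [r], the blocks being laid out in the order of the
    common preference.  By induction on [r], every list in the support of a Bayes
    Nash equilibrium obtains this school: once all better-ranked students take
    theirs, nothing better is left, and a list consisting of this school alone
    secures it.  The equilibrium outcome is thus a function of the lottery only,
    the same as under truthful unconstrained lists, and the probabilities follow
    by counting permutations. *)
Require Import Defs.
From mathcomp Require Import all_boot all_order all_fingroup all_algebra.
From mathcomp Require Import finmap.

Import Order.TTheory GRing.Theory Num.Theory.
Local Open Scope ring_scope.

Set Implicit Arguments.
Unset Strict Implicit.
Unset Printing Implicit Defensive.

(** * Deferred acceptance as a serial dictatorship *)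

Lemma leq_card_top (T : finType) (g : T -> nat) (q : nat) (A : {set T}) :
  injective g -> (q <= #|A|)%N ->
  (q <= #|[set j in A | (#|[set k in A | (g k < g j)%N]| < q)%N]|)%N.
Proof.
move=> g_inj; move cA: #|A| => c; elim: c A cA => [|c IHc] A cA.
  by rewrite leqn0 => /eqP ->.
rewrite leq_eqVlt => /predU1P[def_q|]; last rewrite ltnS => le_qc.
  rewrite -cA in def_q; rewrite {1}def_q subset_leq_card //.
  apply/subsetP=> j jA; rewrite inE jA def_q /= proper_card //.
  apply/properP; split; first by apply/subsetP=> k; rewrite inE => /andP[].
  by exists j => //; rewrite inE ltnn andbF.
have [x0 x0A] : exists x, x \in A by apply/card_gt0P; rewrite cA.
(* Drop the worst-ranked member: it precedes nobody, so the counts for the others do not change. *)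
pose x := [arg max_(y > x0 in A) g y].
have [xA x_max] : x \in A /\ forall y, y \in A -> (g y <= g x)%N.
  by rewrite /x; case: arg_maxnP.
have cAx : #|A :\ x| = c by move: cA; rewrite (cardsD1 x) xA => -[].
apply: leq_trans (IHc _ cAx le_qc) _; apply/subset_leq_card/subsetP=> j.
rewrite !inE => /andP[/andP[j_x jA] lt_jq]; rewrite jA /=.
apply: leq_ltn_trans lt_jq; apply/subset_leq_card/subsetP=> k.
rewrite !inE => /andP[kA lt_kj]; rewrite kA lt_kj !andbT.
by apply: contraTneq lt_kj => ->; rewrite -leqNgt x_max.
Qed.

Section DeferredAcceptanceTheory.

Variables (n m : nat) (q : 'I_m -> nat).
Variables (P : 'I_n -> seq 'I_m) (pi : {perm 'I_n}).
Implicit Type rej : {set 'I_n * 'I_m}.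

Let step := da_step q P pi.

Definition rivals rej (i : 'I_n) (s : 'I_m) : {set 'I_n} :=
  [set j | (application P rej j == Some s) && (pi j < pi i)%N].

(** Rejections only accumulate, so [k] steps either have reached a fixed point or have produced at
    least [k] rejections; [n * m] of them exhaust all pairs. *)
Lemma da_step_iter_fix : step (iter (n * m) step set0) = iter (n * m) step set0.
Proof.
have stepS rej : rej \subset step rej by rewrite subsetUl.
have: forall k, step (iter k step set0) = iter k step set0 \/
                (k <= #|iter k step set0|)%N.
  elim=> [|k [fix_k|le_k]]; [by right | by left; rewrite /= !fix_k |].
  have [eq_k|neq_k] := eqVneq (step (iter k step set0)) (iter k step set0).
    by left; rewrite /= !eq_k.
  right; apply: leq_ltn_trans le_k _; rewrite proper_card //.
  by rewrite properEneq eq_sym neq_k stepS.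
move=> /(_ (n * m)%N)[//|full]; apply/eqP.
have /eqP-> : iter (n * m) step set0 == setT.
  by rewrite eqEcard subsetT cardsT card_prod !card_ord.
by rewrite eqEsubset subsetT stepS.
Qed.

Lemma application_notin rej i s :
  application P rej i = Some s -> (i, s) \notin rej.
Proof.
by rewrite /application; elim: (P i) => //= x p IHp; case: ifPn => // ? [<-].
Qed.

Lemma application_step rej i s :
  application P rej i = Some s -> (i, s) \notin step rej ->
  application P (step rej) i = Some s.
Proof.
rewrite /application => app_i is_s.
have sub x : (i, x) \notin step rej -> (i, x) \notin rej.
  by apply: contra; apply: (subsetP (subsetUl _ _)).
elim: (P i) app_i => //= x p IHp.
have [x_rej [xs]|x_rej /IHp app_p] := ifPn; first by rewrite xs is_s.
by rewrite ifN //; apply: contra x_rej => /sub.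
Qed.

(** A rejection stays justified at all later steps: among the better-ranked applicants, the best
    [q s] are not rejected in the next step and keep applying to [s]. *)
Lemma rejected_rivals k i s :
  (i, s) \in iter k step set0 -> (q s <= #|rivals (iter k step set0) i s|)%N.
Proof.
elim: k i s => [|k IHk] i s; first by rewrite inE.
rewrite /=; set rej := iter k step set0 in IHk *.
move=> is_s.
have {is_s} : (q s <= #|rivals rej i s|)%N.
  by move: is_s; rewrite in_setU => /orP[/IHk//|]; rewrite inE => /andP[].
have pi_inj : injective (fun j => nat_of_ord (pi j)).
  by move=> j k' /val_inj/perm_inj.
move=> /(leq_card_top pi_inj)/leq_trans-> //.
apply/subset_leq_card/subsetP=> j; rewrite !inE => /andP[/andP[app_j lt_ji]].
rewrite lt_ji andbT ltnNge => top_j.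
apply/eqP/application_step; first exact/eqP.
rewrite in_setU negb_or; apply/andP; split.
  exact/application_notin/eqP.
rewrite inE /= app_j; apply: contra top_j => /leq_trans-> //.
apply/subset_leq_card/subsetP=> k'; rewrite !inE => /andP[-> lt_k'j].
by rewrite lt_k'j (ltn_trans lt_k'j lt_ji).
Qed.

(** At the fixed point a school that rejected [i] has at least [q s] better applicants, and the one
    holding [i] has fewer, or another step would reject him. Schools listed below the latter do not
    affect [ohead]. *)
Lemma DA_serial i :
  DA q P pi i =
  ohead [seq s <- P i |
    (#|[set j | (DA q P pi j == Some s) && (pi j < pi i)%N]| < q s)%N].
Proof.
set rej := iter (n * m) step set0.
have rejE : step rej = rej by exact: da_step_iter_fix.
have in_rej s : (i, s) \in rej -> (q s <= #|rivals rej i s|)%N.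
  exact: rejected_rivals.
have held s : application P rej i = Some s -> (#|rivals rej i s| < q s)%N.
  move=> app_i; rewrite ltnNge; apply/negP=> full.
  have: (i, s) \in rej by rewrite -rejE in_setU inE /= app_i eqxx full orbT.
  by apply/negP/application_notin.
rewrite /DA -/step -/rej; transitivity (application P rej i) => //.
rewrite {1}/application; move: held; rewrite /application.
elim: (P i) => //= x p IHp.
have [/in_rej|x_rej /(_ x erefl) open_x] /= := boolP ((i, x) \in rej).
  by rewrite leqNgt => /negbTE->.
by rewrite [X in if X then _ else _]open_x.
Qed.

End DeferredAcceptanceTheory.

(** * Seat blocks and serial choice *)

Lemma card_ord_interval n (a b : nat) :
  (b <= n)%N -> #|[set x : 'I_n | (a <= x < b)%N]| = (b - a)%N.
Proof.
move=> le_bn; rewrite cardsE -sum1_card.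
rewrite (eq_bigl (fun x : 'I_n => (a <= x)%N && (x < b)%N)) //.
rewrite -(big_ord_widen_cond n (leq a) (fun=> 1%N)) //.
by rewrite -(big_geq_mkord a b xpredT (fun=> 1%N)) sum_nat_const_nat muln1.
Qed.

Section Seats.

Variables (n m : nat) (q : 'I_m -> nat).
Hypothesis sum_q : (\sum_(s < m) q s)%N = n.
Implicit Types (r : nat) (s t : 'I_m) (L : seq 'I_m).

(** The argument is a natural number, not a school, so that [first_seat m] can express the total
    capacity. *)
Definition first_seat (k : nat) : nat := (\sum_(s < m | (s < k)%N) q s)%N.

(* The lottery numbers are cut into consecutive blocks, one per school and of
   its capacity, in the order of the common preference. *)
Definition seat r s : bool := (first_seat s <= r < first_seat s + q s)%N.

Lemma first_seatS s : first_seat s.+1 = (first_seat s + q s)%N.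
Proof.
rewrite /first_seat (bigD1 s) //= addnC; congr (_ + _)%N.
by apply: eq_bigl => t; rewrite ltnS ltn_neqAle andbC.
Qed.

Lemma leq_first_seat k k' :
  (k <= k')%N -> (first_seat k <= first_seat k')%N.
Proof.
move=> le_kk'; rewrite /first_seat [leqLHS]big_mkcond [leqRHS]big_mkcond.
by apply: leq_sum => s _; case: ifP => // /leq_trans->.
Qed.

Lemma first_seat_max : first_seat m = n.
Proof. by rewrite -sum_q; apply: eq_bigl => s; rewrite ltn_ord. Qed.

Lemma last_seat_max s : (first_seat s + q s <= n)%N.
Proof. by rewrite -first_seatS -first_seat_max leq_first_seat. Qed.

Lemma seat_exists r : (r < n)%N -> exists s, seat r s.
Proof.
rewrite -first_seat_max; move: (leqnn m); move: {1 3}m => k.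
elim: k => [|k IHk] lt_km; first by rewrite /first_seat big_pred0.
have [lt_rk _|le_kr] := ltnP r (first_seat k); first exact: IHk (ltnW _) _.
move=> lt_rk; exists (Ordinal lt_km).
by rewrite /seat le_kr -(first_seatS (Ordinal lt_km)).
Qed.

Lemma seat_uniq r s t : seat r s -> seat r t -> s = t.
Proof.
wlog le_st : s t / (s <= t)%N => [IH rs rt|].
  by case/orP: (leq_total s t) => /IH; [|move=> IH'; symmetry]; auto.
case/andP=> _ lt_rs /andP[le_tr _]; apply/val_inj/eqP; rewrite eqn_leq le_st /=.
rewrite leqNgt; apply: contraL (leq_ltn_trans le_tr lt_rs) => lt_st.
by rewrite -leqNgt -first_seatS leq_first_seat.
Qed.

Lemma card_seat s : #|[set r : 'I_n | seat r s]| = q s.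
Proof. by rewrite card_ord_interval ?last_seat_max // addKn. Qed.

Definition taken r s : nat := #|[set r' : 'I_n | seat r' s && (r' < r)%N]|.

(** The whole block of [s] ends before the block of [t] begins, hence before [r]. *)
Lemma taken_full r s t : seat r t -> (s < t)%N -> (q s <= taken r s)%N.
Proof.
case/andP=> le_tr _ lt_st; rewrite -{1}(card_seat s).
apply/subset_leq_card/subsetP=> r'; rewrite !inE => rs; rewrite rs /=.
case/andP: rs => _ /leq_trans-> //; apply: leq_trans le_tr.
by rewrite -first_seatS leq_first_seat.
Qed.

Lemma taken_lt r t : seat r t -> (taken r t < q t)%N.
Proof.
move=> rt; have [le_tr lt_rt] := andP rt.
have le_rn : (r <= n)%N := leq_trans (ltnW lt_rt) (last_seat_max t).
(* The numbers counted lie between [first_seat t] and [r], with [r] itself excluded. *)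
apply: (@leq_ltn_trans (r - first_seat t)%N); last by rewrite ltn_subLR.
rewrite -(card_ord_interval (first_seat t) le_rn).
apply/subset_leq_card/subsetP=> r'; rewrite !inE.
by move=> /andP[/andP[-> _] ->].
Qed.

(* What a list yields to lottery number r when everyone ranked above sits in
   his own seat. *)
Definition serial r L : option 'I_m := ohead [seq s <- L | (taken r s < q s)%N].

(** For [r < n] exactly one [t] qualifies, by [seat_exists] and [seat_uniq]. *)
Definition serves r L : Prop := forall t, seat r t -> serial r L = Some t.

Lemma serial_ge r t L s : seat r t -> serial r L = Some s -> (t <= s)%N.
Proof.
move=> rt; rewrite /serial; elim: L => //= x L IHL.
case: ifPn => // lt_x [<-]; rewrite leqNgt; apply: contraL lt_x => lt_xt.
by rewrite -leqNgt (taken_full rt).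
Qed.

Lemma serves_seat1 r t : seat r t -> serves r [:: t].
Proof.
move=> rt s rs; rewrite -(seat_uniq rt rs) /serial /=.
by rewrite taken_lt.
Qed.

(** The school [t] is still open, so the head of the sorted list of open schools is no worse than
    [t]; by [serial_ge] it is no better. *)
Lemma serves_sorted r (e : rel 'I_m) L :
  transitive e -> sorted e L -> (forall s, s \in L) ->
  (forall s t, e s t -> (s <= t)%N) -> serves r L.
Proof.
move=> e_tr e_L all_L e_le t rt.
have : t \in [seq s <- L | (taken r s < q s)%N].
  by rewrite mem_filter taken_lt ?all_L.
have := sorted_filter e_tr (fun s => taken r s < q s)%N e_L.
have := @serial_ge r t L; rewrite /serial.
case: [seq s <- L | _] => //= x F /(_ x rt erefl) le_tx /(order_path_min e_tr).
move=> /allP xF; rewrite inE => /predU1P[->//|/xF/e_le le_xt].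
by congr Some; apply/val_inj/eqP; rewrite eqn_leq le_xt le_tx.
Qed.

(** Strong induction on the lottery number turns the counts in [DA_serial] into [taken]. The list of
    [i] himself is unconstrained, so deviations by [i] are covered too. *)
Lemma DA_eq_serial (P : 'I_n -> seq 'I_m) (pi : {perm 'I_n}) i :
  (forall j, (pi j < pi i)%N -> serves (pi j) (P j)) ->
  DA q P pi i = serial (pi i) (P i).
Proof.
have [r] := ubnP (pi i); elim: r i => // r IHr i; rewrite ltnS => le_ir above.
rewrite DA_serial; congr ohead; apply: eq_filter => s; congr (_ < _)%N.
(* [taken] counts lottery numbers while [DA_serial] counts students; [pi] is a bijection between
   them. *)
rewrite /taken -[RHS](card_preimset _ (@perm_inj _ pi)).
apply: eq_card => j; rewrite !inE; have [lt_ji|] := ltnP; last by rewrite !andbF.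
have -> : DA q P pi j = serial (pi j) (P j).
  apply: IHr => [|k lt_kj]; first exact: leq_trans le_ir.
  exact: above (ltn_trans lt_kj lt_ji).
have [t jt] := seat_exists (ltn_ord (pi j)).
rewrite !andbT (above _ lt_ji _ jt); apply/eqP/idP => [[<-]//|js].
by rewrite (seat_uniq jt js).
Qed.

End Seats.

(** * Counting lotteries *)

Lemma card_lottery n (i : 'I_n) (A : {set 'I_n}) :
  (#|[set pi : {perm 'I_n} | pi i \in A]| * n = #|A| * n`!)%N.
Proof.
pose c r := #|[set pi : {perm 'I_n} | pi i == r]|.
have c_const r : c r = c i.
  (* Composing with the transposition of [r] and [i] carries the lotteries giving [i] number [r] to
     those fixing [i]. *)
  rewrite /c -(card_imset _ (mulIg (tperm r i))); apply: eq_card => pi.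
  rewrite inE; apply/imsetP/eqP => [[pi' + ->]|pi_i].
    by rewrite inE => /eqP pi'_i; rewrite permM pi'_i tpermL.
  exists (pi * tperm r i)%g; last by rewrite -mulgA tperm2 mulg1.
  by rewrite inE permM pi_i tpermR.
have cardE (B : {set 'I_n}) :
    #|[set pi : {perm 'I_n} | pi i \in B]| = (#|B| * c i)%N.
  rewrite -sum1_card (partition_big (fun pi : {perm 'I_n} => pi i) (mem B)) /=.
    rewrite -sum_nat_const; apply: eq_bigr => r rB.
    rewrite -(c_const r) /c -sum1_card; apply: eq_bigl => pi.
    by rewrite !inE andb_idl // => /eqP->.
  by move=> pi; rewrite inE.
have def_n : n`! = (n * c i)%N.
  have := cardE setT; rewrite cardsT card_ord => <-; rewrite -card_Sn.
  by apply: eq_card => pi; rewrite !inE.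
by rewrite cardE def_n -mulnA [(c i * n)%N]mulnC.
Qed.

(** * The joint law of utilities and lottery *)

Section RevealGameTheory.

Variables (R : realFieldType) (n m l : nat) (q : 'I_m -> nat).
Variables (V : {fset 'rV[R]_m}) (f : V -> R) (u0 : R).
Hypothesis hq : (\sum_(s < m) q s)%N = n.
Hypothesis hVdec :
  forall (v : V) (j k : 'I_m), (j < k)%N -> val v 0 k < val v 0 j.
Hypothesis f_gt0 : forall v, 0 < f v.
Hypothesis hu0 : forall (v : V) (k : 'I_m), u0 < val v 0 k.

Implicit Types (sigma : 'I_n -> strategy n l V) (w : play n l V).
Implicit Types (i r : 'I_n) (v : V) (t s : 'I_m) (L : rol m l).
Implicit Type pick_rol : 'I_n -> rol m l.

Let profile sigma := forall i, is_strategy (sigma i).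
Let serves r (L : seq 'I_m) := serves n q r L.
Let serial r (L : seq 'I_m) := serial n q r L.

(** The prior probability of [G] once [f] sums to 1; in general its unnormalised mass. *)
Definition weight (G : pred {ffun 'I_n -> V}) : R :=
  \sum_(theta | G theta) \prod_i f (theta i).

Lemma weight_gt0 (G : pred {ffun 'I_n -> V}) theta : G theta -> 0 < weight G.
Proof.
move=> G_theta; rewrite /weight (bigD1 theta) //= ltr_wpDr ?prodr_gt0 //.
by apply: sumr_ge0 => *; apply: prodr_ge0 => *; apply: ltW.
Qed.

Lemma mass_ge0 sigma w : profile sigma -> 0 <= mass f sigma w.
Proof.
move=> strat; rewrite /mass !mulr_ge0 ?invr_ge0 ?ler0n //.
  by apply: prodr_ge0 => j _; apply: ltW.
by apply: prodr_ge0 => j _; have [] := strat j (types w j) (lottery w j).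
Qed.

Lemma mass_neq0 sigma w i :
  mass f sigma w != 0 -> sigma i (types w i) (lottery w i) (lists w i) != 0.
Proof.
apply: contraNneq => sigma0.
by rewrite /mass [X in _ * X](bigD1 i) //= sigma0 mul0r mulr0.
Qed.

(** Summing out the lists first, the sum of products factors into one total per student, each equal
    to 1. So utilities and lottery are independent, with a law that does not depend on the
    strategies. *)
Lemma Pr_types_lottery sigma (G : pred {ffun 'I_n -> V})
    (H : pred {perm 'I_n}) : profile sigma ->
  Pr f sigma (fun w => G (types w) && H (lottery w))
  = weight G * (#|[set pi | H pi]|%:R / n`!%:R).
Proof.
move=> strat.
pose F (theta : {ffun 'I_n -> V}) (pi : {perm 'I_n})
  (L : {ffun 'I_n -> rol m l}) := (\prod_i f (theta i)) * (n`!%:R)^-1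
  * \prod_i sigma i (theta i) (pi i) (L i).
transitivity (\sum_(x : {ffun 'I_n -> V} * {perm 'I_n} | G x.1 && H x.2)
   \sum_(L : {ffun 'I_n -> rol m l}) F x.1 x.2 L).
  rewrite (pair_big_dep _ (fun _ => xpredT) (fun x => F x.1 x.2)) /=.
  by apply: eq_bigl => w; rewrite andbT.
rewrite -(pair_big_dep G (fun _ => H)
   (fun theta pi => \sum_(L : {ffun 'I_n -> rol m l}) F theta pi L)) /=.
rewrite /weight mulr_suml; apply: eq_bigr => theta _.
rewrite -[in RHS]sum1_card natr_sum mulr_suml mulr_sumr.
apply: eq_big => [pi|pi _]; first by rewrite inE.
rewrite /F -mulr_sumr -(bigA_distr_bigA (fun i => sigma i (theta i) (pi i))).
by rewrite [X in _ * X]big1 ?mulr1 ?mul1r // => j _; have [] := strat j (theta j) (pi j).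
Qed.

Lemma Pr_types sigma (G : pred {ffun 'I_n -> V}) : profile sigma ->
  Pr f sigma (fun w => G (types w)) = weight G.
Proof.
move=> strat; have := Pr_types_lottery G xpredT strat.
rewrite cardsT card_Sn divff ?mulr1 => [<-|]; last first.
  by rewrite pnatr_eq0 -lt0n fact_gt0.
by apply: eq_bigl => w; rewrite andbT.
Qed.

Lemma Pr_info_gt0 sigma i v r : profile sigma -> 0 < Pr f sigma (info i v r).
Proof.
move=> strat; rewrite (Pr_types_lottery (fun theta => theta i == v)
  (fun pi : {perm 'I_n} => pi i == r)) // mulr_gt0 //.
  by apply: (@weight_gt0 _ [ffun=> v]); rewrite ffunE.
rewrite divr_gt0 ?ltr0n ?fact_gt0 //.
by apply/card_gt0P; exists (tperm i r); rewrite inE tpermL.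
Qed.

(** * Bounds on payoffs *)

Lemma utility_inj v t a : utility u0 v a = val v 0 t -> a = Some t.
Proof.
case: a => [s|] /= uE; last by have := hu0 v t; rewrite uE ltxx.
congr Some; apply/val_inj/eqP.
by case: ltngtP => //= /(hVdec v)/lt_eqF/eqP[]; first exact: esym uE.
Qed.

(** One's own seat is a ceiling on what any list can yield: by [serial_ge] nothing better is
    left. *)
Lemma utility_serial_le v r t (L : seq 'I_m) :
  seat q r t -> utility u0 v (serial r L) <= val v 0 t.
Proof.
move=> rt; case E: (serial r L) => [s|] /=; last exact/ltW/hu0.
have := serial_ge hq rt E; rewrite leq_eqVlt => /predU1P[/val_inj->//|].
by move/(hVdec v)/ltW.
Qed.

Lemma truthful_serves v r : serves r (truthful v).
Proof.
apply: (serves_sorted hq (e := fun j k : 'I_m => val v 0 k <= val v 0 j)).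
- by move=> x y z le_yx le_zy; apply: le_trans le_zy le_yx.
- by apply: sort_sorted => x y; apply: le_total.
- by move=> s; rewrite mem_sort mem_enum.
- by move=> s t; rewrite leNgt leqNgt; apply: contra => /(hVdec v).
Qed.

(** In plays of nonzero mass every list lies in the support of its strategy, so [DA_eq_serial]
    applies; the other plays contribute 0. *)
Lemma sum_payoff_serial sigma i v r :
  (forall j v' r' L, j != i -> (r' < r)%N -> sigma j v' r' L != 0 ->
     serves r' L) ->
  \sum_(w | info i v r w) mass f sigma w * payoff q u0 i w =
  \sum_(w | info i v r w) mass f sigma w * utility u0 v (serial r (lists w i)).
Proof.
move=> above; apply: eq_bigr => w /andP[/eqP wv /eqP wr].
have [->|mass_w] := eqVneq (mass f sigma w) 0; first by rewrite !mul0r.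
rewrite /payoff wv /outcome_DAl (DA_eq_serial hq) ?wr // => j lt_jr.
apply: above (mass_neq0 j mass_w) => //.
by apply: contraTneq lt_jr => ->; rewrite wr ltnn.
Qed.

Lemma sum_payoff_served sigma i v r t : seat q r t ->
  (forall j v' r' L, j != i -> (r' < r)%N -> sigma j v' r' L != 0 ->
     serves r' L) ->
  (forall L, sigma i v r L != 0 -> serves r L) ->
  \sum_(w | info i v r w) mass f sigma w * payoff q u0 i w =
  Pr f sigma (info i v r) * val v 0 t.
Proof.
move=> rt above serves_i; rewrite (sum_payoff_serial v above) mulr_suml.
apply: eq_bigr => w /andP[/eqP wv /eqP wr].
have [->|/(mass_neq0 i)] := eqVneq (mass f sigma w) 0; first by rewrite !mul0r.
by rewrite wv wr => /serves_i/(_ t rt) => E; rewrite /serial E.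
Qed.

(** * Existence and support of equilibria *)

Definition pure (pick_rol : 'I_n -> rol m l) : strategy n l V :=
  fun _ r L => (L == pick_rol r)%:R.

Lemma pure_strategy pick_rol : is_strategy (pure pick_rol).
Proof.
move=> v r; split=> [L|]; first exact: ler0n.
rewrite (bigD1 (pick_rol r)) //= /pure eqxx big1 ?addr0 // => L.
by move/negbTE->.
Qed.

Lemma pure_neq0 pick_rol v r L : pure pick_rol v r L != 0 -> L = pick_rol r.
Proof. by rewrite /pure; case: (L =P pick_rol r) => // _; rewrite eqxx. Qed.

Lemma profile_deviate sigma i tau :
  profile sigma -> is_strategy tau -> profile (deviate sigma i tau).
Proof. by move=> ? ? j; rewrite /deviate; case: eqP. Qed.

(** This lets the denominators cancel when equilibrium and deviation payoffs are compared. *)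
Lemma Pr_deviate_info sigma i tau v r : profile sigma -> is_strategy tau ->
  Pr f (deviate sigma i tau) (info i v r) = Pr f sigma (info i v r).
Proof.
move=> strat stau; have strat' := profile_deviate i strat stau.
pose G (theta : {ffun 'I_n -> V}) := theta i == v.
pose H (pi : {perm 'I_n}) := pi i == r.
by rewrite (Pr_types_lottery G H strat') (Pr_types_lottery G H strat).
Qed.

Lemma exists_play sigma i v r L : profile sigma -> sigma i v r L != 0 ->
  exists w, [/\ 0 < mass f sigma w, info i v r w & lists w i = L].
Proof.
move=> strat sigma_L; pose pi := tperm i r.
(* Everyone has utilities [v]; [i] submits [L], and each other student a list of positive
   probability, which exists because the probabilities sum to 1. *)
have /fin_all_exists[h hP] j : exists L', 0 < sigma j v (pi j) L' /\
    (j = i -> L' = L).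
  have [strat0 strat1] := strat j v (pi j).
  have [ji|j_i] := eqVneq j i.
    by exists L; rewrite lt_neqAle strat0 ji tpermL eq_sym sigma_L.
  suff /existsP[L' L'_gt0] : [exists L', 0 < sigma j v (pi j) L'].
    by exists L'; split=> // /eqP; rewrite (negbTE j_i).
  apply: contraT => /existsPn le0.
  have := oner_neq0 R; rewrite -strat1 big1 ?eqxx // => L' _.
  by apply/eqP; rewrite eq_le strat0 andbT leNgt; apply: le0.
exists ([ffun=> v], pi, [ffun j => h j]); split; last 2 first.
- by rewrite /info /types /lottery /= ffunE tpermL !eqxx.
- by rewrite /lists /= ffunE; apply: (hP i).2.
rewrite /mass /types /lottery /lists /= !mulr_gt0 ?invr_gt0 ?ltr0n ?fact_gt0 //.
  by apply: prodr_gt0.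
by apply: prodr_gt0 => j _; rewrite !ffunE; case: (hP j).
Qed.

Hypothesis l_gt0 : (0 < l)%N.

Lemma own_seat_rol : exists pick_rol : 'I_n -> rol m l,
  forall r, serves r (pick_rol r).
Proof.
apply: fin_all_exists (fun r L => serves r L) _ => r.
have [t rt] := seat_exists hq (ltn_ord r).
have size_t : (size [:: t] <= l)%N by [].
exists (exist (fun L : l.-bseq 'I_m => uniq L) (Bseq size_t) isT).
exact: serves_seat1.
Qed.

(** When all others obtain their own seats, the ceiling of [utility_serial_le] binds every
    deviation, and the prescribed list attains it. *)
Lemma bayes_nash_own_seat pick_rol : (forall r, serves r (pick_rol r)) ->
  bayes_nash q f u0 (fun=> pure pick_rol).
Proof.
move=> own; have strat : profile (fun=> pure pick_rol).
  by move=> i; apply: pure_strategy.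
split=> // i tau stau v r; have [t rt] := seat_exists hq (ltn_ord r).
have strat' := profile_deviate i strat stau.
rewrite /condE Pr_deviate_info // ler_pM2r ?invr_gt0 ?Pr_info_gt0 //.
rewrite [leRHS](sum_payoff_served rt) => [|j v' r' L _ _ /pure_neq0->|L /pure_neq0->] //.
rewrite sum_payoff_serial => [|j v' r' L /negbTE j_i _]; last first.
  by rewrite /deviate j_i => /pure_neq0->.
(* Back to the probability under the deviation, so that both sides weigh plays by the same masses
   and compare termwise. *)
rewrite -(Pr_deviate_info i _ _ strat stau) mulr_suml; apply: ler_sum => w _.
by rewrite ler_wpM2l ?mass_ge0 ?utility_serial_le.
Qed.

(* By induction on the lottery number: submitting only one's own seat secures it
   and nothing better is left, so any other list in the support would make that
   deviation profitable. *)
Lemma bayes_nash_serves sigma i v r L :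
  bayes_nash q f u0 sigma -> sigma i v r L != 0 -> serves r L.
Proof.
case=> strat nash; have [pick_rol own] := own_seat_rol.
have [k] := ubnP (r : nat); elim: k i v r L => // k IHk i v r L.
rewrite ltnS => le_rk sigma_L t rt.
have above j v' r' L' : (r' < r)%N -> sigma j v' r' L' != 0 -> serves r' L'.
  by move=> lt_r'r; apply: IHk; apply: leq_trans le_rk.
have stau := pure_strategy pick_rol.
have := nash i (pure pick_rol) stau v r.
rewrite /condE Pr_deviate_info // ler_pM2r ?invr_gt0 ?Pr_info_gt0 //.
rewrite (sum_payoff_served rt) => [|j v' r' L' /negbTE j_i lt_r'r|L']; last 2 first.
- by rewrite /deviate j_i; apply: above.
- by rewrite /deviate eqxx => /pure_neq0->.
rewrite Pr_deviate_info // sum_payoff_serial => [|j v' r' L' _]; last exact: above.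
have [w [mass_w info_w <-]] := exists_play strat sigma_L.
(* Shortfalls from the ceiling are nonnegative, and the equilibrium inequality makes their weighted
   sum nonpositive. So each term vanishes, in particular at [w], which has positive mass and in
   which [i] submits the given list. *)
have loss_ge0 w' : info i v r w' ->
    0 <= mass f sigma w' * (val v 0 t - utility u0 v (serial r (lists w' i))).
  by rewrite mulr_ge0 ?mass_ge0 ?subr_ge0 ?utility_serial_le.
rewrite mulr_suml -subr_le0 -sumrB => le0.
have /eqP : \sum_(w' | info i v r w')
    mass f sigma w' * (val v 0 t - utility u0 v (serial r (lists w' i))) = 0.
  apply/eqP; rewrite eq_le sumr_ge0 // andbT.
  by under eq_bigr do rewrite mulrBr.
rewrite psumr_eq0 // => /allP/(_ w (mem_index_enum _))/implyP/(_ info_w).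
by rewrite mulf_eq0 gt_eqF //= subr_eq0 eq_sym => /eqP/utility_inj.
Qed.

(** * Equilibrium outcomes and assignment probabilities *)

Lemma bayes_nash_outcome sigma w i t :
  bayes_nash q f u0 sigma -> mass f sigma w != 0 -> seat q (lottery w i) t ->
  outcome_DAl q w i = Some t.
Proof.
move=> nash mass_w wt.
have all_served j : serves (lottery w j) (lists w j).
  exact: bayes_nash_serves nash (mass_neq0 j mass_w).
rewrite /outcome_DAl (DA_eq_serial hq) => [|j _]; last exact: all_served.
exact: all_served.
Qed.

Lemma truthful_outcome w i t :
  seat q (lottery w i) t -> outcome_DA q w i = Some t.
Proof.
move=> wt; rewrite /outcome_DA (DA_eq_serial hq) => [|j _].
  exact: truthful_serves.
exact: truthful_serves.
Qed.

(** The equilibrium outcome depends on the lottery only, hence is independent of any event [G] on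
    utilities; varying [G] gives the interim and ex-ante views. *)
Lemma Pr_outcome sigma (G : pred {ffun 'I_n -> V}) i s :
  bayes_nash q f u0 sigma ->
  Pr f sigma (fun w => (outcome_DAl q w i == Some s) && G (types w)) =
  weight G * ((q s)%:R / n%:R).
Proof.
move=> nash; have [strat _] := nash.
transitivity
  (Pr f sigma (fun w => G (types w) && (seat q (lottery w i) s))).
  rewrite /Pr big_mkcond [RHS]big_mkcond; apply: eq_bigr => w _.
  have [->|mass_w] := eqVneq (mass f sigma w) 0; first by rewrite !if_same.
  have [t wt] := seat_exists hq (ltn_ord (lottery w i)).
  rewrite (bayes_nash_outcome nash mass_w wt) andbC; congr (if _ && _ then _ else _).
  by apply/eqP/idP => [[<-]//|ws]; rewrite (seat_uniq wt ws).
rewrite (Pr_types_lottery G (fun pi : {perm 'I_n} => seat q (pi i) s)) //.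
congr (_ * _); have n_gt0 : (0 < n)%N by apply: leq_ltn_trans (ltn_ord i).
(* Cross-multiplying gives the identity of [card_lottery] for the block of [s]. *)
apply/eqP; rewrite eqr_div ?pnatr_eq0 -?lt0n ?fact_gt0 // -!natrM eqr_nat.
rewrite -(card_seat hq s) -(card_lottery i); apply/eqP; congr (_ * _)%N.
by apply: eq_card => pi; rewrite !inE.
Qed.

(** The witness [theta] makes [weight G] positive, so it cancels. *)
Lemma condPr_outcome sigma (G : pred {ffun 'I_n -> V}) theta i s :
  bayes_nash q f u0 sigma -> G theta ->
  condPr f sigma (fun w => outcome_DAl q w i == Some s)
                 (fun w => G (types w)) = (q s)%:R / n%:R.
Proof.
move=> nash G_theta; have [strat _] := nash.
rewrite /condPr Pr_types //.
have -> := Pr_outcome G i s nash.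
by rewrite mulrC mulKf // gt_eqF // (weight_gt0 G_theta).
Qed.

End RevealGameTheory.

Theorem proposition1 (R : realFieldType) (n m l : nat) (q : 'I_m -> nat)
  (V : {fset 'rV[R]_m}) (f : V -> R) (u0 : R)
  (hl : (0 < l < m)%N)
  (hq : (\sum_(s < m) q s)%N = n)
  (hV01 : forall (v : V) (k : 'I_m), 0 <= val v 0 k <= 1)
  (hVdec : forall (v : V) (j k : 'I_m), (j < k)%N -> val v 0 k < val v 0 j)
  (hf01 : forall v : V, 0 < f v < 1)
  (hf1 : \sum_(v : V) f v = 1)
  (hu0 : forall (v : V) (k : 'I_m), u0 < val v 0 k) :
  (exists sigma : 'I_n -> strategy n l V, bayes_nash q f u0 sigma) /\
  forall sigma : 'I_n -> strategy n l V, bayes_nash q f u0 sigma ->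
    (forall w : play n l V, 0 < mass f sigma w ->
       (forall i : 'I_n, outcome_DAl q w i = outcome_DA q w i) /\
       (forall i : 'I_n, outcome_DAl q w i <> None)) /\
    (forall (theta : {ffun 'I_n -> V}) (i : 'I_n) (s : 'I_m),
       condPr f sigma (fun w => outcome_DAl q w i == Some s)
                      (fun w => types w == theta) = (q s)%:R / n%:R) /\
    (forall (i : 'I_n) (v : V) (s : 'I_m),
       condPr f sigma (fun w => outcome_DAl q w i == Some s)
                      (fun w => types w i == v) = (q s)%:R / n%:R) /\
    (forall (i : 'I_n) (s : 'I_m),
       Pr f sigma (fun w => outcome_DAl q w i == Some s) = (q s)%:R / n%:R).
Proof.
have f_gt0 v : 0 < f v by case/andP: (hf01 v).
have l_gt0 : (0 < l)%N by case/andP: hl.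
split.
  have [pick_rol own] := own_seat_rol hq l_gt0.
  exists (fun=> pure pick_rol); exact: bayes_nash_own_seat.
move=> sigma nash; split=> [w /lt0r_neq0 mass_w|].
  have outE i : exists2 t, outcome_DAl q w i = Some t &
                           outcome_DA q w i = Some t.
    have [t wt] := seat_exists hq (ltn_ord (lottery w i)).
    exists t; first exact: (bayes_nash_outcome hq hVdec f_gt0 hu0 l_gt0 nash).
    exact: truthful_outcome.
  by split=> i; have [t -> truthE] := outE i; rewrite ?truthE.
have cond_outcome := fun G theta i s =>
  @condPr_outcome _ _ _ _ q V f u0 hq hVdec f_gt0 hu0 l_gt0 _ G theta i s nash.
split=> [theta i s|].
  exact: (cond_outcome (pred1 theta) theta i s (eqxx theta)).
split=> [i v s|i s].
  by apply: (cond_outcome (fun theta => theta i == v) [ffun=> v]); rewrite ffunE.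
(* The total weight is the [n]-th power of the sum of [f]. *)
have weight1 : weight f (n := n) xpredT = 1.
  by rewrite /weight -(bigA_distr_bigA (fun _ => f)) hf1 big1.
have := Pr_outcome hq hVdec f_gt0 hu0 l_gt0 xpredT i s nash.
rewrite weight1 mul1r => <-.
by apply: eq_bigl => w; rewrite andbT.
Qed.
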